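(* Let $G$ be a finite simple graph. Then $G$ is perfectly colorable if and only if $G$ is perfect and paw-free.
   Context: All graphs are finite and simple. For a graph $H$, $\omega(H)$ denotes its clique number (the maximum size of a set of pairwise adjacent vertices) and $\chi(H)$ its chromatic number. A graph $G$ is perfect if $\omega(H)=\chi(H)$ for every induced subgraph $H$ of $G$. A perfect coloring of $G$ is a proper vertex coloring of $G$ such that for every (nonempty) connected induced subgraph $H$ of $G$, the number of distinct colors appearing on the vertices of $H$ is exactly $\omega(H)$. A graph is perfectly colorable if it admits a perfect coloring. The paw is the graph on four vertices $a,b,c,d$ with edge set $\{ab, bc, ac, cd\}$ (a triangle with one pendant edge attached). A graph is paw-free if it has no induced subgraph isomorphic to the paw. *)

(* Defs.v *)
From HB Require Import structures.
From mathcomp Require Import all_boot.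

Set Implicit Arguments.
Unset Strict Implicit.
Unset Printing Implicit Defensive.

Record sgraph := SGraph {
  vertex :> finType;
  adj : rel vertex;
  adj_sym : symmetric adj;
  adj_irrefl : irreflexive adj
}.

Section Induced.
Variables (G : sgraph) (S : {set G}).

Definition induced_adj : rel {x : G | x \in S} :=
  fun x y => adj (val x) (val y).

Fact induced_adj_sym : symmetric induced_adj.
Proof. by move=> x y; apply: adj_sym. Qed.

Fact induced_adj_irrefl : irreflexive induced_adj.
Proof. by move=> x; apply: adj_irrefl. Qed.

Definition induced : sgraph := SGraph induced_adj_sym induced_adj_irrefl.

End Induced.

Definition isomorphic (G H : sgraph) : Prop :=
  exists2 f : G -> H, bijective f & forall x y, adj (f x) (f y) = adj x y.

Definition clique (G : sgraph) (A : {set G}) : bool :=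
  [forall x in A, forall y in A, (x != y) ==> adj x y].

Definition omega (G : sgraph) : nat := \max_(A : {set G} | clique A) #|A|.

Definition proper_coloring (G : sgraph) (C : finType) (c : G -> C) : bool :=
  [forall x, forall y, adj x y ==> (c x != c y)].

Definition k_colorable (G : sgraph) (k : nat) : bool :=
  [exists c : {ffun G -> 'I_k}, proper_coloring c].

Fact k_colorable_ex (G : sgraph) : exists k, k_colorable G k.
Proof.
exists #|G|; apply/existsP; exists [ffun x => enum_rank x].
apply/forallP => x; apply/forallP => y; apply/implyP => xy.
rewrite !ffunE (inj_eq enum_rank_inj).
by apply: contraTneq xy => ->; rewrite adj_irrefl.
Qed.

Definition chi (G : sgraph) : nat := ex_minn (k_colorable_ex G).

Definition perfect (G : sgraph) : Prop :=
  forall S : {set G}, omega (induced S) = chi (induced S).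

(* The null graph is not connected. *)
Definition connected (G : sgraph) : Prop :=
  0 < #|G| /\ forall x y : G, connect (@adj G) x y.

Definition perfect_coloring (G : sgraph) (C : finType) (c : G -> C) : Prop :=
  proper_coloring c /\
  forall S : {set G}, connected (induced S) -> #|c @: S| = omega (induced S).

(* As G is finite, finite sets of colors lose no generality. *)
Definition perfectly_colorable (G : sgraph) : Prop :=
  exists (C : finType) (c : G -> C), perfect_coloring c.

(* Vertices a, b, c, d are 0, 1, 2, 3; edges ab, bc, ac, cd. *)
Definition paw_edges : seq (nat * nat) := [:: (0, 1); (1, 2); (0, 2); (2, 3)].

Definition paw_adj : rel 'I_4 := fun x y =>
  ((val x, val y) \in paw_edges) || ((val y, val x) \in paw_edges).

Fact paw_adj_sym : symmetric paw_adj.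
Proof. by move=> x y; rewrite /paw_adj orbC. Qed.

Fact paw_adj_irrefl : irreflexive paw_adj.
Proof. by case=> [[|[|[|[|m]]]] lt_m4]. Qed.

Definition paw : sgraph := SGraph paw_adj_sym paw_adj_irrefl.

Definition paw_free (G : sgraph) : Prop :=
  forall S : {set G}, ~ isomorphic (induced S) paw.

(* Main.v *)
(* If c is a perfect coloring, then on every connected component K of an
   induced subgraph H it uses omega(K) <= omega(H) colors, so renumbering the
   colors inside each component gives chi(H) <= omega(H); and the ends of an
   induced path on three vertices get the same color, which is impossible in
   the two such paths of a paw that meet in the pendant edge.

   Conversely (Olariu), in a paw-free graph every vertex connected to a triangle
   is adjacent to at least two of its vertices; hence in a component with a
   triangle, non-adjacent vertices have the same neighborhood.  Color such
   components by neighborhoods; the remaining components form a triangle-free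
   perfect graph, which is 2-colorable. *)
Require Import Defs.
From mathcomp Require Import all_boot.

Set Implicit Arguments.
Unset Strict Implicit.
Unset Printing Implicit Defensive.

(** * Cliques and colorings of induced subgraphs *)

Lemma cliqueP (G : sgraph) (A : {set G}) :
  reflect {in A &, forall x y, x != y -> adj x y} (clique A).
Proof.
apply: (iffP forall_inP) => [cA x y xA yA | cA x xA].
  by move/(_ x xA)/forall_inP/(_ y yA)/implyP: cA.
by apply/forall_inP => y yA; apply/implyP; apply: cA.
Qed.

Lemma proper_coloringP (G : sgraph) (C : finType) (c : G -> C) :
  reflect (forall x y, adj x y -> c x != c y) (proper_coloring c).
Proof.
apply: (iffP forallP) => [pc x y | pc x].
  by move/(_ x)/forallP/(_ y)/implyP: pc.
by apply/forallP => y; apply/implyP; apply: pc.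
Qed.

Lemma clique1 (G : sgraph) (x : G) : clique [set x].
Proof.
by apply/cliqueP => y z; rewrite !inE => /eqP -> /eqP ->; rewrite eqxx.
Qed.

Lemma clique2 (G : sgraph) (x y : G) : adj x y -> clique [set x; y].
Proof.
move=> xy; apply/cliqueP => z t; rewrite !inE.
by move=> /orP[] /eqP -> /orP[] /eqP ->; rewrite ?eqxx // adj_sym.
Qed.

Lemma card_clique_colors (G : sgraph) (C : finType) (c : G -> C) (A : {set G}) :
  proper_coloring c -> clique A -> #|c @: A| = #|A|.
Proof.
move=> /proper_coloringP pc /cliqueP cA; apply: card_in_imset => x y xA yA.
by apply: contra_eq => /(cA x y xA yA)/pc.
Qed.

(** Together with [omega_induced_witness], this reduces [omega (induced S)] to cliques of [G] inside
    [S], away from the subtype. *)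
Lemma clique_leq_omega (G : sgraph) (S A : {set G}) :
  A \subset S -> clique A -> #|A| <= omega (induced S).
Proof.
move=> /subsetP sAS /cliqueP cA; set B : {set induced S} := [set x | val x \in A].
have defA : A = val @: B.
  apply/setP => x; apply/idP/imsetP => [xA | [y]]; last by rewrite inE => ? ->.
  by exists (Sub x (sAS x xA)); rewrite ?inE.
rewrite defA (card_imset _ val_inj); apply: (bigmax_sup B) => //.
apply/cliqueP => x y; rewrite !inE => xA yA xy.
by apply: (cA (val x) (val y)).
Qed.

Lemma omega_induced_witness (G : sgraph) (S : {set G}) :
  exists A : {set G}, [/\ A \subset S, clique A & #|A| = omega (induced S)].
Proof.
have clique_neq0 : 0 < #|[pred A : {set induced S} | clique A]|.
  by apply/card_gt0P; exists set0; apply/cliqueP => x y; rewrite inE.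
have [B /cliqueP cB omegaE] := eq_bigmax_cond (fun B : {set _} => #|B|) clique_neq0.
exists (val @: B); split; last by rewrite (card_imset _ val_inj) [RHS]omegaE.
  by apply/subsetP => _ /imsetP[x _ ->]; apply: valP.
apply/cliqueP => _ _ /imsetP[x xB ->] /imsetP[y yB ->] xy.
by apply: (cB x y xB yB); apply: contraNneq xy => ->.
Qed.

Lemma omega_induced_sub (G : sgraph) (S T : {set G}) :
  S \subset T -> omega (induced S) <= omega (induced T).
Proof.
move=> sST; have [A [sAS cA <-]] := omega_induced_witness S.
by apply: clique_leq_omega cA; apply: subset_trans sST.
Qed.

Lemma omega_leq_colors (G : sgraph) (C : finType) (c : G -> C) (S : {set G}) :
  proper_coloring c -> omega (induced S) <= #|c @: S|.
Proof.
move=> pc; have [A [sAS cA <-]] := omega_induced_witness S.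
by rewrite -(card_clique_colors pc cA) subset_leq_card ?imsetS.
Qed.

Lemma omega_leq_chi (G : sgraph) : omega G <= chi G.
Proof.
rewrite /chi; case: ex_minnP => k /existsP[c pc] _.
apply/bigmax_leqP => A cA; rewrite -(card_clique_colors pc cA) -[k in _ <= k]card_ord.
exact: max_card.
Qed.

Lemma chi_leq (G : sgraph) k : k_colorable G k -> chi G <= k.
Proof. by rewrite /chi; case: ex_minnP => m _; apply. Qed.

(** * Components of an induced subgraph *)

Definition adj_in (G : sgraph) (S : {set G}) : rel G :=
  fun x y => [&& x \in S, y \in S & adj x y].

Lemma adj_in_sym (G : sgraph) (S : {set G}) : symmetric (adj_in S).
Proof. by move=> x y; rewrite /adj_in adj_sym andbCA. Qed.

Lemma connect_induced (G : sgraph) (S : {set G}) (x y : induced S) :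
  connect (adj_in S) (val x) (val y) -> connect (@adj (induced S)) x y.
Proof.
case/connectP => p; elim: p x => [|z p IHp] x /=.
  by move=> _ /val_inj ->; apply: connect0.
case/andP => /and3P[_ zS xz] zp yE.
apply: (connect_trans (connect1 (y := Sub z zS : induced S) xz)).
exact: IHp.
Qed.

Lemma connect_val (G : sgraph) (S : {set G}) (x y : induced S) :
  connect (@adj (induced S)) x y -> connect (@adj G) (val x) (val y).
Proof.
case/connectP => p; elim: p x => [|z p IHp] x /= => [_ -> // | /andP[xz zp] yE].
exact: connect_trans (connect1 (e := @adj G) xz) (IHp z zp yE).
Qed.

Lemma connected_induced (G : sgraph) (S : {set G}) (x : G) :
  x \in S -> {in S, forall y, connect (adj_in S) x y} -> connected (induced S).
Proof.
move=> xS cS; split; first by apply/card_gt0P; exists (Sub x xS : induced S).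
move=> y z; apply: connect_induced.
apply: connect_trans (cS _ (valP z)).
by rewrite (sym_connect_sym (adj_in_sym S)) cS ?(valP y).
Qed.

(** For [x] outside [S] only the empty path remains, and this is [[set x]]. *)
Definition component (G : sgraph) (S : {set G}) (x : G) : {set G} :=
  [set y | connect (adj_in S) x y].

Lemma component_sub (G : sgraph) (S : {set G}) (x : G) :
  x \in S -> component S x \subset S.
Proof.
move=> xS; apply/subsetP => y; rewrite inE => /connectP[p + ->].
by elim/last_ind: p => // p z _; rewrite rcons_path last_rcons => /andP[_ /and3P[]].
Qed.

(** All vertices on an [adj_in S] path from [x] lie in the component, so the path stays valid for
    [adj_in (component S x)]. *)
Lemma connected_component (G : sgraph) (S : {set G}) (x : G) :
  connected (induced (component S x)).
Proof.
apply: (@connected_induced _ _ x) => [|y]; first by rewrite inE connect0.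
rewrite inE => /connectP[p + ->]; elim/last_ind: p => [|p z IHp] /=.
  by move=> _; apply: connect0.
rewrite rcons_path last_rcons => /andP[xp pz].
apply: connect_trans (IHp xp) (connect1 _).
have cp : connect (adj_in S) x (last x p) by apply/connectP; exists p.
rewrite /adj_in !inE cp (connect_trans cp (connect1 pz)).
by case/and3P: pz.
Qed.

(** * From perfect colorings to perfection and paw-freeness *)

Lemma perfect_coloring_perfect (G : sgraph) (C : finType) (c : G -> C) :
  perfect_coloring c -> perfect G.
Proof.
move=> [/proper_coloringP pc cE] S; apply/eqP; rewrite eqn_leq omega_leq_chi /=.
apply: chi_leq.
(* The new color of [x] is the position of [c (val x)] in this list. The list depends only on the
   component, so neighbors share it and get different positions. *)
pose palette (x : induced S) := enum (c @: component S (val x)).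
have rank_lt x : index (c (val x)) (palette x) < omega (induced S).
  apply: leq_trans (omega_induced_sub (component_sub (valP x))).
  rewrite -(cE _ (connected_component S (val x))) cardE index_mem mem_enum.
  by apply: imset_f; rewrite inE connect0.
apply/existsP; exists [ffun x => Ordinal (rank_lt x)].
apply/proper_coloringP => x y xy; rewrite !ffunE -val_eqE /=.
have eq_palette : palette x = palette y.
  rewrite /palette; suff -> : component S (val x) = component S (val y) by [].
  apply/setP => z; rewrite !inE.
  apply: (same_connect1 (sym_connect_sym (adj_in_sym S))).
  by rewrite /adj_in (valP x) (valP y).
have x_palette : c (val x) \in palette x.
  by rewrite mem_enum imset_f // inE connect0.
apply: contra (pc _ _ xy) => /eqP eq_rank; apply/eqP.
rewrite -(nth_index (c (val x)) x_palette) eq_rank eq_palette nth_index //.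
by rewrite mem_enum imset_f // inE connect0.
Qed.

(** Three distinct colors on this path would force a clique of size 3, that is, the whole path,
    although [p] and [r] are not adjacent. *)
Lemma perfect_coloring_P3 (G : sgraph) (C : finType) (c : G -> C) (p q r : G) :
  perfect_coloring c -> adj p q -> adj q r -> ~~ adj p r -> p != r -> c p = c r.
Proof.
move=> [pc cE] pq qr pr p_neq_r; have/proper_coloringP adj_neq := pc.
set S : {set G} := [set p; q; r].
have [pS qS rS] : [/\ p \in S, q \in S & r \in S] by rewrite !inE !eqxx !orbT.
have connS : connected (induced S).
  apply: (connected_induced qS) => x; rewrite !inE -orbA => /or3P[]/eqP -> //.
    by apply: connect1; rewrite /adj_in qS pS adj_sym.
  by apply: connect1; rewrite /adj_in qS rS.
apply/eqP/negPn/negP => cpr.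
have cS : #|c @: S| = #|S|.
  have [cpq cqr] := (adj_neq _ _ pq, adj_neq _ _ qr).
  apply: card_in_imset => x y; rewrite !inE -!orbA.
  by case/or3P=> /eqP -> /or3P[]/eqP -> //;
    move/eqP; rewrite ?[_ == c p]eq_sym ?[_ == c q]eq_sym
      ?(negPf cpq) ?(negPf cqr) ?(negPf cpr) // eq_sym
      ?(negPf cpq) ?(negPf cqr) ?(negPf cpr).
have [A [sAS /cliqueP cA cardA]] := omega_induced_witness S.
have defA : A = S by apply/eqP; rewrite eqEcard sAS cardA -cE // cS leqnn.
by case/negP: pr; apply: cA; rewrite ?defA.
Qed.

Lemma perfect_coloring_paw_free (G : sgraph) (C : finType) (c : G -> C) :
  perfect_coloring c -> paw_free G.
Proof.
move=> perf S [f [g fK gK] fE].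
pose h i := val (g i).
have hE i j : adj (h i) (h j) = paw_adj i j by rewrite -[LHS]fE !gK.
have h_inj : injective h by move=> i j /val_inj/(can_inj gK).
pose i0 : 'I_4 := @Ordinal 4 0 isT; pose i1 : 'I_4 := @Ordinal 4 1 isT.
pose i2 : 'I_4 := @Ordinal 4 2 isT; pose i3 : 'I_4 := @Ordinal 4 3 isT.
have c03 : c (h i0) = c (h i3).
  by apply: (perfect_coloring_P3 (q := h i2) perf); rewrite ?hE ?(inj_eq h_inj).
have c13 : c (h i1) = c (h i3).
  by apply: (perfect_coloring_P3 (q := h i2) perf); rewrite ?hE ?(inj_eq h_inj).
have /proper_coloringP/(_ (h i0) (h i1)) := perf.1.
by rewrite hE c03 c13 eqxx => /(_ isT).
Qed.

(** * Triangles in paw-free graphs *)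

(** Otherwise [w] hangs on the triangle at [p] alone, and the four vertices induce a paw. *)
Lemma paw_free_triangle (G : sgraph) (p q r w : G) : paw_free G ->
  adj p q -> adj q r -> adj p r -> adj w p -> adj w q || adj w r.
Proof.
move=> pawG pq qr pr wp; apply/norP => -[wq wr].
have adj_neq (x y : G) : adj x y -> x != y.
  by apply: contraTneq => ->; rewrite adj_irrefl.
(* In the order of the vertices 0, 1, 2, 3 of the paw: [p] is the vertex of degree three and [w] the
   pendant one. *)
pose s := [:: q; r; p; w].
pose h (i : 'I_4) := nth p s i.
have hE i j : adj (h i) (h j) = paw_adj i j.
  move: (@adj G) (@adj_irrefl G) (@adj_sym G) pq qr pr wp wq wr.
  move=> e eI eC pq qr pr wp /negPf wq /negPf wr.
  case: i j => [[|[|[|[|i]]]] lti] [[|[|[|[|j]]]] ltj] //;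
    rewrite /h /= ?eI //;
    first [by rewrite ?pq ?qr ?pr ?wp ?wq ?wr | by rewrite eC ?pq ?qr ?pr ?wp ?wq ?wr].
have s_uniq : uniq s.
  have [qw rw] : q != w /\ r != w.
    by split; [apply: contraNneq wr | apply: contraNneq wq] => <-; rewrite // adj_sym.
  rewrite /= !inE !negb_or qw rw (adj_neq _ _ qr) eq_sym (adj_neq _ _ pq).
  by rewrite [r == p]eq_sym (adj_neq _ _ pr) [p == w]eq_sym (adj_neq _ _ wp).
have h_inj : injective h.
  by move=> i j /eqP; rewrite nth_uniq // => /eqP/val_inj.
have hS i : h i \in h @: setT by rewrite imset_f.
pose g i : induced (h @: setT) := Sub (h i) (hS i).
have g_inj : injective g by move=> i j /(congr1 val)/h_inj.
have card_g : #|induced (h @: setT)| <= #|'I_4|.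
  by rewrite card_sig -cardsT; apply: leq_imset_card.
have [f gK fK] := inj_card_bij g_inj card_g.
apply: (pawG (h @: setT)); exists f; first by exists g.
move=> x y; rewrite -{2}(fK x) -{2}(fK y).
exact/esym/hE.
Qed.

(** Induction along a path from [a]. If [u] sees two vertices of the triangle, it forms a triangle
    with them, so its successor [w] sees one of the two; [paw_free_triangle] on the original
    triangle then gives [w] a second neighbor there. *)
Lemma triangle_two_neighbors (G : sgraph) (a b d v : G) : paw_free G ->
  adj a b -> adj b d -> adj a d -> connect (@adj G) a v ->
  [|| adj v a && adj v b, adj v b && adj v d | adj v a && adj v d].
Proof.
move=> pawG ab bd ad /connectP[p + ->]; elim/last_ind: p => [|p w IHp] /=.
  by rewrite adj_irrefl ab ad.
rewrite rcons_path last_rcons => /andP[/IHp].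
move: (last a p) => u {p IHp} u_two; rewrite adj_sym => wu.
have {u u_two wu} /or3P[wa|wb|wd] : [|| adj w a, adj w b | adj w d].
- case/or3P: u_two => /andP[us ut].
  + by case/orP: (paw_free_triangle pawG us ab ut wu) => ->; rewrite ?orbT.
  + by case/orP: (paw_free_triangle pawG us bd ut wu) => ->; rewrite ?orbT.
  + by case/orP: (paw_free_triangle pawG us ad ut wu) => ->; rewrite ?orbT.
- by case/orP: (paw_free_triangle pawG ab bd ad wa) => ->; rewrite wa ?orbT.
- have ba : adj b a by rewrite adj_sym.
  by case/orP: (paw_free_triangle pawG ba ad bd wb) => ->; rewrite wb ?orbT.
- have [db da] : adj d b /\ adj d a by rewrite !(adj_sym d).
  have ba : adj b a by rewrite adj_sym.
  by case/orP: (paw_free_triangle pawG db ba da wd) => ->; rewrite wd ?orbT.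
Qed.

(* The edge [yz] has a common neighbor on the triangle, since each end misses at
   most one of its vertices; [x] then sees two vertices of the new triangle. *)
Lemma triangle_edge_neighbor (G : sgraph) (a b d x y z : G) : paw_free G ->
  adj a b -> adj b d -> adj a d ->
  connect (@adj G) a x -> connect (@adj G) a y -> adj y z ->
  adj x y || adj x z.
Proof.
move=> pawG ab bd ad ax ay yz.
have az : connect (@adj G) a z := connect_trans ay (connect1 yz).
have yx : connect (@adj G) y x.
  by apply: connect_trans ax; rewrite (sym_connect_sym (@adj_sym G)).
have [t /andP[yt zt]] : exists t, adj y t && adj z t.
  have := triangle_two_neighbors pawG ab bd ad ay.
  have := triangle_two_neighbors pawG ab bd ad az.
  case: (boolP (adj y a && adj z a)) => [|na]; first by exists a.
  case: (boolP (adj y b && adj z b)) => [|nb]; first by exists b.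
  case: (boolP (adj y d && adj z d)) => [|nd]; first by exists d.
  move: na nb nd.
  by do 6!case: (adj _ _).
have := triangle_two_neighbors pawG yz zt yt yx.
by case/or3P=> /andP[-> _]; rewrite ?orbT.
Qed.

(** * Coloring a perfect paw-free graph *)

Definition triangle_connected (G : sgraph) (x : G) : bool :=
  [exists a, exists b, exists d,
    [&& connect (@adj G) a x, adj a b, adj b d & adj a d]].

Lemma triangle_connectedP (G : sgraph) (x : G) :
  reflect (exists a b d,
             [/\ connect (@adj G) a x, adj a b, adj b d & adj a d])
          (triangle_connected x).
Proof.
apply: (iffP existsP) => [[a /existsP[b /existsP[d /and4P[ax ab bd ad]]]]|].
  by exists a, b, d.
move=> [a [b [d [ax ab bd ad]]]]; exists a; apply/existsP; exists b.
by apply/existsP; exists d; apply/and4P.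
Qed.

Lemma triangle_connected_connect (G : sgraph) (x y : G) :
  connect (@adj G) x y -> triangle_connected x = triangle_connected y.
Proof.
move=> xy; suff imp u v : connect (@adj G) u v ->
    triangle_connected u -> triangle_connected v.
  by apply/idP/idP; apply: imp; rewrite // (sym_connect_sym (@adj_sym G)).
move=> uv /triangle_connectedP[a [b [d [au ab bd ad]]]].
apply/triangle_connectedP; exists a, b, d; split=> //; exact: connect_trans uv.
Qed.

Lemma omega_triangle_free (G : sgraph) :
  (forall x y z : G, adj x y -> adj y z -> ~~ adj x z) -> omega G <= 2.
Proof.
move=> free; apply/bigmax_leqP => A /cliqueP cA; rewrite leqNgt.
apply/negP => /card_gt2P[x [y [z [[xA yA zA] [xy yz zx]]]]].
have := free x y z (cA _ _ xA yA xy) (cA _ _ yA zA yz).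
by rewrite adj_sym cA.
Qed.

(** One representative per color gives a clique with as many vertices as there are colors. *)
Lemma card_set_colors (G : sgraph) (C : finType) (c : G -> C) (S : {set G}) :
  (forall x y, x \in S -> y \in S -> c x != c y -> adj x y) ->
  #|c @: S| <= omega (induced S).
Proof.
(* The [pick] depends only on the color of [x], so each color selects one vertex. The default is
   never reached for [x] in [S], since [x] itself qualifies. *)
move=> cadj; pose A := [set x in S | x == odflt x [pick y in S | c y == c x]].
have repr x : x \in S -> exists2 y, y \in A & c y = c x.
  move=> xS; case pickE: [pick y in S | c y == c x] => [y|]; last first.
    by move: pickE; case: pickP => // /(_ x); rewrite xS eqxx.
  have [yS /eqP cy] : y \in S /\ c y == c x.
    by move: pickE; case: pickP => // z /andP[zS cz] [<-].
  by exists y; rewrite // inE yS cy pickE eqxx.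
have A_inj : {in A &, injective c}.
  move=> x y; rewrite !inE => /andP[xS /eqP xE] /andP[yS /eqP yE] cxy.
  rewrite {}xE {}yE cxy; case: pickP => //= /(_ x).
  by rewrite xS cxy eqxx.
have -> : c @: S = c @: A.
  apply/setP => k; apply/imsetP/imsetP => -[x xS ->].
    by have [y yA cy] := repr x xS; exists y.
  by exists x => //; move: xS; rewrite inE => /andP[].
rewrite (card_in_imset A_inj); apply: clique_leq_omega.
  by apply/subsetP => x; rewrite inE => /andP[].
apply/cliqueP => x y xA yA xy; apply: cadj.
- by move: xA; rewrite inE => /andP[].
- by move: yA; rewrite inE => /andP[].
- by apply: contraNneq xy => /(A_inj _ _ xA yA) ->.
Qed.

Lemma paw_free_perfectly_colorable (G : sgraph) :
  perfect G -> paw_free G -> perfectly_colorable G.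
Proof.
move=> perfG pawG; pose S := [set x : G | ~~ triangle_connected x].
(* Here [k] is the chromatic number of [induced S], equal to its clique number by perfection. *)
have [k k_le2 [b pb]] : exists2 k, k <= 2 &
    exists b : induced S -> 'I_k, proper_coloring b.
  exists (chi (induced S)); last first.
    by rewrite /chi; case: ex_minnP => k /existsP[b pb] _; exists b.
  rewrite -perfG; apply: omega_triangle_free => x y z xy yz; apply/negP => xz.
  have := valP x; rewrite inE => /triangle_connectedP[].
  by exists (val x), (val y), (val z); split.
(* The two summands keep the kinds of colors apart; [option] only absorbs [insub], which succeeds on
   [S]. *)
pose c x : {set G} + option 'I_k :=
  if triangle_connected x then inl [set y | adj x y] else inr (omap b (insub x)).
have cS (x : induced S) : c (val x) = inr (Some (b x)).
  by rewrite /c valK; have := valP x; rewrite inE => /negPf ->.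
have pc : proper_coloring c.
  apply/proper_coloringP => x y xy; apply/negP => /eqP cxy.
  have tc := triangle_connected_connect (connect1 (e := @adj G) xy).
  case tx: (triangle_connected x).
    move: cxy; rewrite /c -tc tx => -[] /setP/(_ y).
    by rewrite !inE xy adj_irrefl.
  have xS : x \in S by rewrite inE tx.
  have yS : y \in S by rewrite inE -tc tx.
  move: cxy; rewrite (cS (Sub x xS)) (cS (Sub y yS)) => -[] /eqP.
  by apply/negP; move/proper_coloringP: pb; apply.
exists _, c; split=> // T [/card_gt0P[x0 _] connT]; apply/eqP.
rewrite eqn_leq (omega_leq_colors _ pc) andbT.
have connG x y : x \in T -> y \in T -> connect (@adj G) x y.
  by move=> xT yT; apply: (connect_val (connT (Sub x xT) (Sub y yT))).
have x0T := valP x0; case tx0: (triangle_connected (val x0)).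
  apply: card_set_colors => x y xT yT.
  have [tx ty] : triangle_connected x /\ triangle_connected y.
    by rewrite -!(triangle_connected_connect (connG _ _ x0T _)) ?tx0.
  (* By contraposition, non-adjacent [x] and [y] must have equal neighborhoods: an edge [xz] forces
     [y] to see [x] or [z], hence [z], and symmetrically. *)
  rewrite /c tx ty; apply: contraNT => xy; apply/eqP; congr inl.
  have /triangle_connectedP[p [q [r [px pq qr pr]]]] := tx.
  have py : connect (@adj G) p y := connect_trans px (connG x y xT yT).
  apply/setP => z; rewrite !inE; apply/idP/idP => [xz | yz].
    have := triangle_edge_neighbor pawG pq qr pr py px xz.
    by rewrite adj_sym (negPf xy).
  by have := triangle_edge_neighbor pawG pq qr pr px py yz; rewrite (negPf xy).
have sTS : T \subset S.
  apply/subsetP => x xT; rewrite inE.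
  by rewrite -(triangle_connected_connect (connG _ _ x0T xT)) tx0.
have cT2 : #|c @: T| <= 2.
  have sub : c @: T \subset [set inr (Some i) | i : 'I_k].
    apply/subsetP => _ /imsetP[x xT ->].
    by rewrite (cS (Sub x (subsetP sTS x xT))) imset_f.
  apply: leq_trans (subset_leq_card sub) _.
  by apply: leq_trans (leq_imset_card _ _) _; rewrite card_ord.
(* A single color is matched by a one-vertex clique. With two colors, [T] has two distinct vertices,
   and the first edge of a path between them is a clique of size 2. *)
have [c_le1 | /card_gt1P[_ [_ [/imsetP[x xT ->] /imsetP[y yT ->] cxy]]]] :=
    leqP #|c @: T| 1.
  apply: leq_trans c_le1 _; rewrite -(cards1 (val x0)).
  by apply: clique_leq_omega (clique1 _); rewrite sub1set.
have [z [t [zT tT zt]]] : exists z t, [/\ z \in T, t \in T & adj z t].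
  have /connectP[[|z p]] := connT (Sub x xT) (Sub y yT).
    by move=> _ /(congr1 val)/= xy; rewrite xy eqxx in cxy.
  by move=> /= /andP[xz _] _; exists x, (val z); split; rewrite ?(valP z).
apply: leq_trans cT2 _; have z_neq_t : z != t.
  by apply: contraTneq zt => ->; rewrite adj_irrefl.
have <- : #|[set z; t]| = 2 by rewrite cards2 z_neq_t.
by apply: clique_leq_omega (clique2 zt); rewrite subUset !sub1set zT.
Qed.

Theorem theorem2 (G : sgraph) :
  perfectly_colorable G <-> perfect G /\ paw_free G.
Proof.
split=> [[C [c pc]] | [perfG pawG]].
  split; first exact: perfect_coloring_perfect pc.
  exact: perfect_coloring_paw_free pc.
exact: paw_free_perfectly_colorable.
Qed.
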